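(* Let $\varrho$ be an arbitrary substitution on a compact Hausdorff alphabet $\mathcal{A}$, with substitution operator $M$, spectral radius $r=r(M)$ and $T=M/r$. For $P\subseteq\mathcal{A}$ and $k\in\mathbb{N}$ define \[ C_k(P)=\max_{a\in\mathcal{A}}\#\{b\triangleleft\varrho^k(a)\mid b\notin P\}, \] where letters of $\varrho^k(a)$ are counted with multiplicity. For finite $P\subseteq\mathcal{A}$ and $k\in\mathbb{N}$: (1) if $P$ consists of only isolated points of $\mathcal{A}$, then $C_k(P)$ is an upper bound for the essential spectral radius of $M^k$; (2) otherwise, $2C_k(P)$ is an upper bound for the essential spectral radius of $M^k$. In particular, if $C_k(P)<r^k$ and $P$ consists of only isolated points, or if $2C_k(P)<r^k$, then $T$ is quasi-compact.
   Context: $\mathcal{A}$ is a compact Hausdorff space and $\mathcal{A}^+=\bigsqcup_{n\ge1}\mathcal{A}^n$ is the space of non-empty finite words (disjoint union of product topologies). A substitution is a continuous map $\varrho\colon\mathcal{A}\to\mathcal{A}^+$, extended to words by concatenation and iterated. The notation $b\triangleleft\varrho^k(a)$ for a letter $b$ ranges over the letter occurrences in $\varrho^k(a)$. $\mathbb{N}=\{1,2,\dots\}$. $E=C(\mathcal{A})$ is the Banach space of continuous real-valued functions with supremum norm, and $M\colon E\to E$ is $(Mf)(a)=\sum_{b\triangleleft\varrho(a)}f(b)$ (with multiplicity). The essential spectral radius of a bounded operator $S$ on $E$ is $r_{\mathrm{ess}}(S)=\lim_{n\to\infty}\big(\inf_C\|S^n-C\|\big)^{1/n}$, the infimum over all compact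 operators $C$ on $E$ (i.e. the spectral radius of $S$ in the Calkin algebra). An operator $T$ with spectral radius $1$ is quasi-compact if there are a compact operator $C$ and $n\in\mathbb{N}$ with $\|T^n-C\|<1$; equivalently $r_{\mathrm{ess}}(T)<1$. *)

(* Defs.v *)
From HB Require Import structures.
From mathcomp Require Import all_boot all_order all_algebra.
From mathcomp Require Import all_classical all_reals all_analysis.

Set Implicit Arguments.
Unset Strict Implicit.
Unset Printing Implicit Defensive.

Import Order.TTheory GRing.Theory Num.Theory.
Import numFieldNormedType.Exports.

Local Open Scope classical_set_scope.
Local Open Scope ring_scope.

HB.mixin Record Topological_isCompactHausdorff T & Topological T := {
  compact_setT : compact [set: T];
  hausdorffT : hausdorff_space T
}.

#[short(type="compactHausdorffType")]
HB.structure Definition CompactHausdorff :=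
  {T of Topological T & Topological_isCompactHausdorff T}.

Section continuous_functions.
Variables (R : realType) (A : compactHausdorffType).

Definition cts : {pred A -> R} := mem [set f : A -> R | continuous f].

Lemma cts_submod_closed : submod_closed cts.
Proof.
split=> [|k f g]; first by rewrite inE => x; exact: cvg_cst.
rewrite !inE => cf cg x.
by apply: cvgD; [apply: cvgZr; exact: cf|exact: cg].
Qed.

HB.instance Definition _ := GRing.isSubmodClosed.Build _ _ cts
  cts_submod_closed.

(* The Banach space C(A) *)
Record cfun := CFun { cfun_val :> A -> R; cfunP : cfun_val \in cts }.

HB.instance Definition _ := [isSub for cfun_val].
HB.instance Definition _ := [Choice of cfun by <:].
HB.instance Definition _ := [SubChoice_isSubLmodule of cfun by <:].

Lemma cfun_continuous (f : cfun) : continuous f.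
Proof. by have := cfunP f; rewrite inE. Qed.

Definition mkcfun (f : A -> R) (cf : continuous f) : cfun := CFun (mem_set cf).

(* sup set0 = 0 takes care of an empty A *)
Definition supnorm (f : cfun) : R := sup [set `|f a| | a in [set: A]].

Lemma supnorm_ub (f : cfun) (a : A) : `|f a| <= supnorm f.
Proof.
apply: ub_le_sup; last by exists a.
have cf : {within [set: A], continuous (f : A -> R)}.
  by apply: continuous_subspaceT => x; exact: cfun_continuous.
have [M [_ Mub]] := compact_bounded (continuous_compact cf (@compact_setT A)).
exists (M + 1) => _ [x _ <-]; apply: Mub; first by rewrite ltrDl.
by exists x.
Qed.

Lemma supnorm_le (f : cfun) (c : R) :
  0 <= c -> (forall a, `|f a| <= c) -> supnorm f <= c.
Proof.
move=> c0 fc; have [[a _]|/set0P/negP] := pselect ([set: A] !=set0).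
  apply: ge_sup; first by exists `|f a|; exists a.
  by move=> _ [x _ <-].
by rewrite negbK /supnorm => /eqP ->; rewrite image_set0 sup0.
Qed.

Lemma supnorm_ge0 (f : cfun) : 0 <= supnorm f.
Proof.
have [[a _]|/set0P/negP] := pselect ([set: A] !=set0).
  exact: le_trans (normr_ge0 _) (supnorm_ub f a).
by rewrite negbK /supnorm => /eqP ->; rewrite image_set0 sup0.
Qed.

Lemma supnormD (f g : cfun) : supnorm (f + g) <= supnorm f + supnorm g.
Proof.
apply: supnorm_le => [|a]; first by rewrite addr_ge0 ?supnorm_ge0.
by apply: le_trans (ler_normD _ _) _; rewrite lerD ?supnorm_ub.
Qed.

Lemma supnormZ (k : R) (f : cfun) : supnorm (k *: f) = `|k| * supnorm f.
Proof.
have leZ (l : R) (g : cfun) : supnorm (l *: g) <= `|l| * supnorm g.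
  apply: supnorm_le => [|a]; first by rewrite mulr_ge0 ?supnorm_ge0.
  by rewrite [X in X <= _](normrM l (g a)) ler_wpM2l ?supnorm_ub.
apply/eqP; rewrite eq_le leZ/=.
have [->|k0] := eqVneq k 0; first by rewrite normr0 mul0r supnorm_ge0.
rewrite -ler_pdivlMl ?normr_gt0// -normfV.
by have := leZ k^-1 (k *: f); rewrite scalerA mulVf// scale1r.
Qed.

Lemma supnorm0_eq0 (f : cfun) : supnorm f = 0 -> f = 0.
Proof.
move=> f0; apply: val_inj; apply/funext => a /=.
by apply/eqP; rewrite -normr_le0 -f0 supnorm_ub.
Qed.

HB.instance Definition _ :=
  Lmodule_isNormed.Build R cfun supnormD supnormZ supnorm0_eq0.

End continuous_functions.

Section operators.
Variables (R : realType) (V : normedModType R).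
Implicit Types S T C : V -> V.

Definition opnorm S : R := sup [set `|S x| | x in [set x | `|x| <= 1]].

Definition compact_operator C : Prop :=
  linear C /\ precompact (C @` [set x | `|x| <= 1]).

Definition spectral_radius S : R :=
  limn (fun n => opnorm (iter n S) `^ n%:R^-1).

Definition ess_spectral_radius S : R :=
  limn (fun n =>
    inf [set opnorm (iter n S \- C) | C in compact_operator] `^ n%:R^-1).

Definition quasi_compact T : Prop :=
  spectral_radius T = 1 /\
  exists C, exists2 n, (0 < n)%N &
    compact_operator C /\ opnorm (iter n T \- C) < 1.

End operators.

(* The space of non-empty finite words: the topological disjoint union of the
   product spaces A^(n+1) for n : nat *)
Definition word (A : topologicalType) : Type :=
  {n : nat & prod_topology (fun _ : 'I_n.+1 => A)}.

HB.instance Definition _ (A : topologicalType) :=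
  Topological.copy (word A)
    {n : nat & prod_topology (fun _ : 'I_n.+1 => A)}.

Definition letters (A : topologicalType) (w : word A) : seq A :=
  [seq projT2 w i | i <- enum 'I_(projT1 w).+1].

Definition substitution (A : topologicalType) := continuousType A (word A).

(* The letters of rho^k(a), listed in order and with multiplicity *)
Definition subst_iter (A : topologicalType) (rho : substitution A)
    (k : nat) (a : A) : seq A :=
  iter k (fun w => flatten [seq letters (rho b) | b <- w]) [:: a].

Section substitution_operator.
Variables (R : realType) (A : compactHausdorffType) (rho : substitution A).

Let M (f : A -> R) (a : A) : R := \sum_(b <- letters (rho a)) f b.

Lemma subst_op_continuous (f : cfun R A) : continuous (M f).
Proof.
pose g n (w : prod_topology (fun _ : 'I_n.+1 => A)) : R :=
  \sum_(i < n.+1) f (w i).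
have cg n : continuous (g n).
  move=> w; have nw := nbhs_filter w.
  apply: (cvg_big add_continuous) => i _.
  apply: (@continuous_comp
    (prod_topology (fun _ : 'I_n.+1 => A)) A R (fun w => w i) f).
    exact: (@proj_continuous _ (fun _ : 'I_n.+1 => A)).
  exact: cfun_continuous.
rewrite (_ : M f = (fun w : word A => g _ (projT2 w)) \o rho); last first.
  by apply/funext => a; rewrite /M /letters big_map big_enum.
move=> a; apply: continuous_comp; first exact: cts_fun.
by case: (rho a) => n w; exact: (cg n w).
Qed.

Definition subst_op (f : cfun R A) : cfun R A :=
  mkcfun (@subst_op_continuous f).

End substitution_operator.

(* The maximum over a of the number of occurrences in rho^k(a) of letters not
   in P; it exists by compactness, see maxcountP *)
Definition maxcount (A : topologicalType) (rho : substitution A)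
    (k : nat) (P : set A) : nat :=
  let N := range (fun a => count (fun b => b \notin P) (subst_iter rho k a)) in
  xget 0%N (N `&` ubound N).

Lemma nbhs_word_length (A : topologicalType) (w : word A) :
  nbhs w [set v | projT1 v = projT1 w].
Proof.
case: w => n w; have nw := nbhs_filter w.
by apply: (@filterS _ (nbhs w)) filterT => v.
Qed.

Lemma maxcountP (A : compactHausdorffType) (rho : substitution A)
    (k : nat) (P : set A) (a0 : A) :
  let c a := count (fun b => b \notin P) (subst_iter rho k a) in
  (exists a, c a = maxcount rho k P) /\ forall a, (c a <= maxcount rho k P)%N.
Proof.
move=> c.
have [L rhoL] : exists L, forall a, (size (letters (rho a)) <= L)%N.
  have /compact_near_coveringP cov := @compact_setT A.
  have H : forall x, [set: A] x -> \forall x' \near x & n \near \oo,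
      (size (letters (rho x')) <= n)%N.
    move=> x _.
    exists ([set y | projT1 (rho y) = projT1 (rho x)],
            [set n | (projT1 (rho x) < n)%N]) => /=.
      split; last exact: nbhs_infty_gt.
      exact: (@cts_fun _ _ rho x _ (nbhs_word_length (rho x))).
    by move=> [y n] /= [yx ?]; rewrite size_map size_enum_ord yx.
  have [L _ /(_ L (leqnn L)) HL] := cov nat \oo
    (fun n a => (size (letters (rho a)) <= n)%N) _ H.
  by exists L => a; exact: HL.
have size_iter a : (size (subst_iter rho k a) <= L ^ k)%N.
  rewrite /subst_iter; elim: k {c} => //= n; set w := iter _ _ _ => IH.
  have /leq_trans -> // : (size (flatten [seq letters (rho b) | b <- w])
      <= L * size w)%N.
    elim: w {IH} => [|b w IHw]/=; first by rewrite muln0.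
    by rewrite size_cat mulnS leq_add.
  by rewrite expnS leq_mul2l IH orbT.
have cL a : (c a <= L ^ k)%N.
  exact: leq_trans (count_size _ _) (size_iter a).
have exc : exists n, `[< exists a, c a = n >].
  by exists (c a0); apply/asboolP; exists a0.
have ubc n : `[< exists a, c a = n >] -> (n <= L ^ k)%N.
  by move=> /asboolP[a <-].
have [] : (range c `&` ubound (range c)) (maxcount rho k P).
  apply: xgetPex; case: (ex_maxnP exc ubc) => m /asboolP[a cm] maxm.
  exists m; split; first by exists a.
  by move=> _ [b _ <-]; apply: maxm; apply/asboolP; exists b.
by move=> [a _ ca] ub; split=> [|b]; [exists a|apply: ub; exists b].
Qed.

(* Main.v *)
(* Let S = M^k, so that S f(a) is the sum of f over the letters of rho^k(a).
   Choose continuous functions phi_p (p in P) with phi_p(q) = [p = q] on P, and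
   put I f = sum_p f(p) phi_p, an operator of finite rank. Since f - I f
   vanishes on P, only the letters outside P contribute to S (f - I f), whence
   |S - S I| <= Ck |1 - I|. If the points of P are isolated, the indicators of
   the points give |1 - I| <= 1; in general Urysohn functions normalised to have
   sum at most 1 give |1 - I| <= 2. *)
Require Import Defs.
From HB Require Import structures.
From mathcomp Require Import all_boot all_order all_algebra.
From mathcomp Require Import all_classical all_reals all_analysis.

Set Implicit Arguments.
Unset Strict Implicit.
Unset Printing Implicit Defensive.

Import Order.TTheory GRing.Theory Num.Theory.
Import numFieldNormedType.Exports.

Local Open Scope classical_set_scope.
Local Open Scope ring_scope.

(** * Bounded and compact operators on a normed space, and the essential spectral radius *)

Section operators.
Variables (R : realType) (V : normedModType R).
Implicit Types S T C D : V -> V.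

Definition bounded_operator S : Prop :=
  linear S /\ exists B : R, forall x, `|S x| <= B * `|x|.

(** Operators are plain functions with linearity as a predicate; bundling gives access to rules such
    as [linearB] and [linearZ]. *)
Lemma linear_pack S : linear S -> exists f : {linear V -> V}, S = f.
Proof.
move=> lS; exists (HB.pack_for {linear V -> V} S
  (GRing.isLinear.Build R V V *:%R S lS)).
by [].
Qed.

Lemma linear_comp S T : linear S -> linear T -> linear (S \o T).
Proof. by move=> lS lT k x y /=; rewrite lT lS. Qed.

Lemma linear_sub_fun S T : linear S -> linear T -> linear (S \- T).
Proof.
by move=> lS lT k x y /=; rewrite lS lT scalerBr opprD addrACA.
Qed.

Lemma bounded_operator_continuous S : bounded_operator S -> continuous S.
Proof.
move=> [/linear_pack[f ->] [B fB]]; apply: bounded_linear_continuous.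
apply/linear_boundedP.
near=> r => x; apply: le_trans (fB x) _.
by rewrite ler_wpM2r//; near: r; exact: nbhs_pinfty_ge.
Unshelve. all: by end_near. Qed.

Lemma bounded_operator_iter S c n : 0 <= c -> linear S ->
  (forall x, `|S x| <= c * `|x|) ->
  linear (iter n S) /\ forall x, `|iter n S x| <= c ^+ n * `|x|.
Proof.
move=> c0 lS Sc; elim: n => [|n [lSn Sn]].
  by split=> // x; rewrite expr0 mul1r.
split=> [|x /=]; first exact: linear_comp.
by apply: le_trans (Sc _) _; rewrite exprS -mulrA ler_wpM2l.
Qed.

Lemma opnorm_ge0 S : 0 <= opnorm S.
Proof.
rewrite /opnorm; set E := [set _ | _ in _].
(* For unbounded [S] the supremum does not exist and [sup] is 0 by default. *)
have [Ssup|/sup_out ->//] := pselect (has_sup E).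
apply: le_trans (normr_ge0 (S 0)) _.
by apply: ub_le_sup; [exact: Ssup.2|exists 0; rewrite //= normr0].
Qed.

Lemma opnorm_le S c : 0 <= c -> (forall x, `|S x| <= c * `|x|) ->
  opnorm S <= c.
Proof.
move=> c0 Sc; apply: ge_sup.
  by exists `|S 0|; exists 0; rewrite //= normr0.
move=> _ [x /= x1 <-]; apply: le_trans (Sc x) _.
by rewrite ler_piMr.
Qed.

(** If [S] is unbounded on the unit ball, so is its positive multiple, and both sides are 0 by the
    default value of [sup]. *)
Lemma opnormZ a S : 0 < a -> opnorm (fun x => a *: S x) = a * opnorm S.
Proof.
move=> a0; rewrite /opnorm.
set E := [set `|S x| | x in _].
rewrite (_ : [set _ | _ in _] = [set a * y | y in E]); last first.
  apply/seteqP; split=> [_ [x x1 <-]|_ [_ [x x1 <-] <-]].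
    by exists `|S x|; [exists x|rewrite normrZ gtr0_norm].
  by exists x => //; rewrite normrZ gtr0_norm.
have E0 : E !=set0 by exists `|S 0|; exists 0; rewrite //= normr0.
have [[_ Eub]|nE] := pselect (has_sup E).
  apply/eqP; rewrite eq_le; apply/andP; split.
    apply: ge_sup; first by case: E0 => e Ee; exists (a * e); exists e.
    by move=> _ [y Ey <-]; rewrite ler_pM2l//; exact: ub_le_sup.
  rewrite -ler_pdivlMl//; apply: ge_sup => // y Ey.
  rewrite ler_pdivlMl//; apply: ub_le_sup; last by exists y.
  case: Eub => u uE; exists (a * u) => _ [z Ez <-].
  by rewrite ler_pM2l//; exact: uE.
rewrite (sup_out nE) mulr0 sup_out// => -[_ [u uE]]; apply: nE; split=> //.
exists (a^-1 * u) => y Ey; rewrite ler_pdivlMl//.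
by apply: uE; exists y.
Qed.

Lemma precompact_sub_compact (X K : set V) :
  X `<=` K -> compact K -> precompact X.
Proof.
move=> XK cK; apply: (precompact_subset XK).
exact/compact_precompact.
Qed.

Lemma precompact_image S (X : set V) : continuous S -> precompact X ->
  precompact (S @` X).
Proof.
move=> cS; rewrite precompactE => cX.
apply: (@precompact_sub_compact _ (S @` closure X)).
  by apply: image_subset; exact: subset_closure.
by apply: continuous_compact => //; exact: continuous_subspaceT.
Qed.

Lemma compact_operator0 : compact_operator (fun _ : V => 0 : V).
Proof.
split=> [k x y|]; first by rewrite scaler0 addr0.
apply: (@precompact_sub_compact _ [set 0]); last exact: compact_set1.
by move=> _ [x _ <-].
Qed.

Lemma compact_operatorD C D : compact_operator C -> compact_operator D ->
  compact_operator (fun x => C x + D x).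
Proof.
move=> [lC cC] [lD cD]; split=> [k x y|].
  by rewrite lC lD scalerDr addrACA.
rewrite !precompactE in cC cD.
(* Addition maps the product of the two compact closures onto a compact set containing the image of
   the unit ball. *)
have cCD := compact_setX cC cD.
have := continuous_compact (continuous_subspaceT (@add_continuous V)) cCD.
apply: precompact_sub_compact => _ [x x1 <-].
exists (C x, D x) => //; split; apply: subset_closure; by exists x.
Qed.

Lemma compact_operator_compl S C : bounded_operator S -> compact_operator C ->
  compact_operator (S \o C).
Proof.
move=> bS [lC cC]; split; first exact: linear_comp bS.1 lC.
rewrite -image_comp; apply: precompact_image => //.
exact: bounded_operator_continuous.
Qed.

Lemma compact_operator_compr S C : bounded_operator S -> compact_operator C ->
  compact_operator (C \o S).
Proof.
move=> [lS [B SB]] [lC cC]; split; first exact: linear_comp.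
(* [S] maps the unit ball into the ball of radius [b], so [C \o S] maps it into [b] times the image
   of the unit ball under [C]. The summand 1 makes [b] invertible. *)
pose b := `|B| + 1.
have b0 : 0 < b by rewrite ltr_wpDl.
have : precompact ((fun x => b *: x) @` (C @` [set x | `|x| <= 1])).
  by apply: precompact_image => //; exact: scaler_continuous.
apply: precompact_subset => _ [x /= x1 <-].
exists (C (b^-1 *: S x)); last first.
  have [f ->] := linear_pack lC.
  by rewrite linearZ/= scalerA divff ?gt_eqF ?scale1r.
exists (b^-1 *: S x) => //=.
rewrite normrZ gtr0_norm ?invr_gt0// ler_pdivrMl// mulr1.
apply: le_trans (SB x) _; apply: (@le_trans _ _ (`|B| * `|x|)).
  by rewrite ler_wpM2r// ler_norm.
by apply: (@le_trans _ _ `|B|); rewrite ?lerDl// ler_piMr.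
Qed.

(** The unit ball lands in the compact segment of all t v with |t| <= 1. Point evaluations on C(A)
    will play the role of [c]. *)
Lemma compact_operator_rank1 (c : V -> R) (v : V) :
  (forall k x y, c (k *: x + y) = k * c x + c y) ->
  (forall x, `|c x| <= `|x|) ->
  compact_operator (fun x => c x *: v).
Proof.
move=> lc c1; split=> [k x y|]; first by rewrite lc scalerDl scalerA.
apply: (@precompact_sub_compact _ ((fun t : R => t *: v) @` `[-1, 1])).
  move=> _ [x /= x1 <-]; exists (c x) => //=.
  by rewrite in_itv/= -ler_norml (le_trans (c1 x)).
apply: continuous_compact; last exact: segment_compact.
by apply: continuous_subspaceT; exact: scalel_continuous.
Qed.

(** With D = S - C, induction on S^(n+1) - D^(n+1) = S (S^n - D^n) + C D^n, where both summands are
    compact. *)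
Lemma compact_operator_iter_sub S C n : bounded_operator S ->
  compact_operator C -> (forall m, bounded_operator (iter m (S \- C))) ->
  compact_operator (iter n S \- iter n (S \- C)).
Proof.
move=> bS cC bD; elim: n => [|n IH].
  suff -> : iter 0 S \- iter 0 (S \- C) = fun=> 0 by exact: compact_operator0.
  by apply/funext => x /=; rewrite subrr.
pose D := S \- C; rewrite -/D in IH *.
suff -> : iter n.+1 S \- iter n.+1 D =
    fun x => (S \o (iter n S \- iter n D)) x + (C \o iter n D) x.
  apply: compact_operatorD; first exact: compact_operator_compl.
  exact: compact_operator_compr.
apply/funext => x; have [f fE] := linear_pack bS.1.
rewrite /=; set y := iter n D x; rewrite -[D y]/(S y - C y).
by rewrite fE !linearB/= opprK addrA.
Qed.

(* The powers S^n and (S - C)^n differ by a compact operator, so the n-th term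
   of the sequence defining the radius is at most c; if that sequence diverged
   its lim would be the default value 0. *)
Lemma ess_spectral_radius_le S C c : 0 <= c -> bounded_operator S ->
  compact_operator C -> (forall x, `|S x - C x| <= c * `|x|) ->
  ess_spectral_radius S <= c.
Proof.
move=> c0 bS cC SCc.
have bD n : linear (iter n (S \- C)) /\
    forall x, `|iter n (S \- C) x| <= c ^+ n * `|x|.
  by apply: bounded_operator_iter => //; exact: linear_sub_fun bS.1 cC.1.
have bD' n : bounded_operator (iter n (S \- C)).
  by split; [exact: (bD n).1|exists (c ^+ n); exact: (bD n).2].
rewrite /ess_spectral_radius; set u := (X in limn X).
have [cu|/dvgP ->//] := pselect (cvgn u).
apply: limr_le => //; near=> n.
(* Since 0^-1 = 0, the identity c = (c^n)^(1/n) used below may fail at n = 0. *)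
have n0 : (0 < n)%N by near: n; exact: nbhs_infty_gt.
rewrite /u; set E := [set _ | _ in _].
have Ege0 : lbound E 0 by move=> _ [D _ <-]; exact: opnorm_ge0.
have Ec : E (opnorm (iter n S \- (iter n S \- iter n (S \- C)))).
  exists (iter n S \- iter n (S \- C)) => //.
  exact: compact_operator_iter_sub.
have infE0 : 0 <= inf E by apply: lb_le_inf => //; eexists; exact: Ec.
have infEc : inf E <= c ^+ n.
  apply: (le_trans (ge_inf _ Ec)); first by exists 0.
  apply: opnorm_le => [|x]; first exact: exprn_ge0.
  by rewrite /= subKr; exact: (bD n).2.
have -> : c = (c ^+ n) `^ n%:R^-1.
  by rewrite -powR_mulrn// -powRrM mulfV ?powRr1// pnatr_eq0 -lt0n.
by apply: ge0_ler_powR => //; rewrite ?nnegrE ?exprn_ge0// invr_ge0.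
Unshelve. all: by end_near. Qed.

(** * Spectral radius and quasi-compactness of the normalized operator *)

Lemma iter_scale S (a : R) n x : linear S ->
  iter n (fun x => a *: S x) x = a ^+ n *: iter n S x.
Proof.
move=> /linear_pack[f ->]; elim: n => [|n IH] /=; first by rewrite scale1r.
by rewrite IH linearZ/= scalerA -exprS.
Qed.

(** For n > 0, the n-th root of the norm of (S/r)^n is r^-1 times that for S^n, so the limit is r^-1
    r. *)
Lemma spectral_radius_normalized S : linear S -> 0 < spectral_radius S ->
  spectral_radius (fun x => (spectral_radius S)^-1 *: S x) = 1.
Proof.
set r := spectral_radius S => lS r0.
have cu : (fun n => opnorm (iter n S) `^ n%:R^-1) @ \oo --> r.
  (* a nonzero value of lim excludes divergence, whose default value is 0 *)
  by apply: cvgNpoint; rewrite -/(spectral_radius S) gt_eqF.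
rewrite -[RHS](mulVf (lt0r_neq0 r0)).
apply: cvg_lim => //.
have cv : (fun n => r^-1 * opnorm (iter n S) `^ n%:R^-1) @ \oo --> r^-1 * r.
  exact: cvgMl_tmp.
apply: (cvg_trans _ cv); apply: near_eq_cvg; near=> n.
have n0 : (0 < n)%N by near: n; exact: nbhs_infty_gt.
rewrite (funext (fun x => iter_scale r^-1 n x lS)) exprVn.
rewrite opnormZ ?invr_gt0 ?exprn_gt0//.
rewrite powRM ?opnorm_ge0 ?invr_ge0 ?exprn_ge0 ?ltW//.
rewrite -exprVn -powR_mulrn ?invr_ge0 ?ltW//.
rewrite -powRrM mulfV ?powRr1 ?invr_ge0 ?ltW//.
by rewrite pnatr_eq0 -lt0n.
Unshelve. all: by end_near. Qed.

Lemma spectral_radius_ge0 S : 0 <= spectral_radius S.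
Proof.
rewrite /spectral_radius; set u := (X in limn X).
have [cu|/dvgP ->//] := pselect (cvgn u).
by apply: limr_ge => //; near=> n; exact: powR_ge0.
Unshelve. all: by end_near. Qed.

(** (S/r)^k is within c / r^k < 1 of the compact operator C / r^k. *)
Lemma quasi_compact_normalized S C c k : (0 < k)%N -> 0 <= c -> linear S ->
  compact_operator C -> (forall x, `|iter k S x - C x| <= c * `|x|) ->
  c < spectral_radius S ^+ k ->
  quasi_compact (fun x => (spectral_radius S)^-1 *: S x).
Proof.
set r := spectral_radius S => k0 c0 lS cC SCc cr.
have r0 : 0 < r.
  (* As k > 0, r = 0 would give r^k = 0, contradicting 0 <= c < r^k. *)
  rewrite lt_def spectral_radius_ge0 andbT; apply/eqP => r0.
  by move: cr; rewrite r0 expr0n eqn0Ngt k0/= ltNge c0.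
split; first exact: spectral_radius_normalized.
exists (fun x => r ^- k *: C x); exists k => //; split.
  apply: compact_operator_compl cC; split=> [a x y|].
    by rewrite scalerDr !scalerA mulrC.
  by exists `|r ^- k| => x; rewrite normrZ.
apply: (@le_lt_trans _ _ (r ^- k * c)).
  apply: opnorm_le => [|x].
    by rewrite mulr_ge0// invr_ge0 exprn_ge0// ltW.
  rewrite /= iter_scale// exprVn -scalerBr normrZ -mulrA.
  rewrite gtr0_norm ?invr_gt0 ?exprn_gt0//.
  by rewrite ler_pM2l ?invr_gt0 ?exprn_gt0.
by rewrite mulrC ltr_pdivrMr ?exprn_gt0// mul1r.
Qed.

End operators.

(** * Finite-rank interpolation of continuous functions at finitely many points *)

Section interpolation.
Variables (R : realType) (A : compactHausdorffType).
Implicit Types (f g : cfun R A) (s : seq A) (phi : A -> cfun R A).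

Lemma cfunDE f g a : (f + g) a = f a + g a. Proof. by []. Qed.

Lemma cfunBE f g a : (f - g) a = f a - g a. Proof. by []. Qed.

Lemma cfunZE (k : R) f a : (k *: f) a = k * f a. Proof. by []. Qed.

Lemma cfun_sumE I (s : seq I) (F : I -> cfun R A) a :
  (\sum_(i <- s) F i) a = \sum_(i <- s) F i a.
Proof. by elim: s => [|i s IH]; rewrite ?big_nil// !big_cons cfunDE IH. Qed.

Lemma cfun_ler_norm f a : `|f a| <= `|f|.
Proof. exact: supnorm_ub. Qed.

Lemma cfun_norm_le f (c : R) : 0 <= c -> (forall a, `|f a| <= c) -> `|f| <= c.
Proof. exact: supnorm_le. Qed.

Definition interp s phi f : cfun R A := \sum_(p <- s) f p *: phi p.

Lemma interp_compact s phi : compact_operator (interp s phi).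
Proof.
elim: s => [|p s IH].
  rewrite (_ : interp [::] phi = fun=> 0); first exact: compact_operator0.
  by apply/funext => f; rewrite /interp big_nil.
rewrite (_ : interp _ phi = fun f => f p *: phi p + interp s phi f); last first.
  by apply/funext => f; rewrite /interp big_cons.
apply: compact_operatorD => //; apply: compact_operator_rank1 => // f.
exact: cfun_ler_norm.
Qed.

Lemma interpE s phi f : uniq s ->
  {in s &, forall p q, phi p q = (p == q)%:R} ->
  {in s, forall q, interp s phi f q = f q}.
Proof.
move=> us phiE q qs; rewrite cfun_sumE (bigD1_seq q)// cfunZE phiE// eqxx mulr1.
rewrite big_seq_cond big1 => [|p /andP[ps pq]]; first exact: addr0.
by rewrite cfunZE phiE// (negPf pq) mulr0.
Qed.

(** With indicators as [phi], the difference is 0 on [s] and equals [f] elsewhere. *)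
Lemma isolated_interp s : uniq s -> [set` s] `<=` isolated [set: A] ->
  exists phi, {in s &, forall p q, phi p q = (p == q)%:R} /\
    forall f, `|f - interp s phi f| <= `|f|.
Proof.
move=> us iso.
have cont p : p \in s -> continuous (fun a => (p == a)%:R : R).
  move=> ps; have [_ [V nV]] := iso _ ps; rewrite setIT => VE.
  (* The indicator is locally constant: at p by the isolating neighbourhood, elsewhere because the
     complement of {p} is open. *)
  move=> a; apply: cvg_near_cst; have [<-{a}|pa] := eqVneq p a.
    by apply: filterS nV => y; rewrite VE => ->; rewrite eqxx.
  have oCp : open (~` [set p]).
    apply: closed_openC; apply: accessible_closed_set1.
    exact/hausdorff_accessible/hausdorffT.
  have /(filterS _) : nbhs a (~` [set p]).
    by apply: open_nbhs_nbhs; split=> //= ap; rewrite ap eqxx in pa.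
  by apply=> y yp; case: eqVneq => // py; case: yp.
have [phi phiE] : exists phi, {in s, forall p a, phi p a = (p == a)%:R}.
  suff /choice[phi phiP] p : exists f, p \in s -> forall a, f a = (p == a)%:R.
    by exists phi => p ps; exact: phiP.
  have [ps|_] := boolP (p \in s); last by exists 0.
  by exists (mkcfun (cont p ps)).
exists phi; split=> [p q ps _|f]; first exact: phiE.
apply: cfun_norm_le => // a; rewrite cfunBE.
have [sa|sa] := boolP (a \in s).
  by rewrite interpE ?subrr ?normr0// => p q ps _; exact: phiE.
rewrite cfun_sumE big_seq big1 => [|p ps]; first by rewrite subr0 cfun_ler_norm.
by rewrite cfunZE phiE//; case: eqVneq ps sa => [->->|_ _ _]//; rewrite mulr0.
Qed.

Lemma separating_functions s : uniq s ->
  exists phi, [/\ {in s &, forall p q, phi p q = (p == q)%:R},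
    forall p a, 0 <= phi p a & forall a, \sum_(p <- s) phi p a <= 1].
Proof.
move=> us.
have closedA (B : set A) : finite_set B -> closed B.
  move: B; apply/accessible_finite_set_closed.
  exact/hausdorff_accessible/hausdorffT.
have normA : normal_space A.
  by apply: compact_normal; [exact: hausdorffT|exact: compact_setT].
(* Urysohn's lemma separates p from the other points of [s]. *)
have /choice[psi psiP] p : exists f : A -> R, [/\ continuous f,
    forall a, 0 <= f a, f p = 1 & {in s, forall q, q != p -> f q = 0}].
  have [||||f [cf f0 f1 f01]] := @urysohn_ext_itv A R normA
    [set` [seq q <- s | q != p]] [set p] 0 1.
  - apply: closedA; exact: finite_seq.
  - apply: closedA; exact: finite_set1.
  - by rewrite -subset0 => q [/=]; rewrite mem_filter => /andP[/eqP].
  - exact: ltr01.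
  exists f; split=> // [a||q qs qp].
  - have /f01/= : range f (f a) by exists a.
    by rewrite in_itv/= => /andP[].
  - by apply: f1; exists p.
  - by apply: f0; exists q => //=; rewrite mem_filter qp.
(* Dividing by [N] makes the sum at most 1, and the maximum with 1 keeps the divisor positive. On
   [s] the [psi p] sum to 1, so their values there are unchanged. *)
pose N a := Num.max 1 (\sum_(p <- s) psi p a).
have N0 a : 0 < N a by rewrite lt_max ltr01.
have cN : continuous N.
  move=> a; apply: continuous_max; first exact: cvg_cst.
  apply: (cvg_big add_continuous) => p _.
  by have [+ _ _ _] := psiP p; exact.
have cphi p : continuous (fun a => psi p a / N a).
  move=> a; apply: cvgM; first by have [+ _ _ _] := psiP p; exact.
  by apply: cvgV; [rewrite gt_eqF|exact: cN].
exists (fun p => mkcfun (cphi p)); split=> [p q ps qs|p a|a] /=.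
- have Nq : N q = 1.
    rewrite /N (bigD1_seq q)//= big_seq_cond big1 ?addr0.
      by have [_ _ -> _] := psiP q; rewrite maxxx.
    by move=> t /andP[ts tq]; have [_ _ _ ->//] := psiP t; rewrite eq_sym.
  rewrite Nq divr1; have [_ _ p1 p0] := psiP p.
  have [<-//|pq] := eqVneq p q.
  by rewrite p0// eq_sym.
- by have [_ + _ _] := psiP p => psi0; rewrite divr_ge0// ltW.
- by rewrite -mulr_suml ler_pdivrMr// mul1r le_max lexx orbT.
Qed.

(** The weights [phi p a] are nonnegative with sum at most 1, so |I f| <= |f|; the triangle
    inequality then gives the constant 2. *)
Lemma separating_interp s : uniq s -> exists phi,
  {in s &, forall p q, phi p q = (p == q)%:R} /\
  forall f, `|f - interp s phi f| <= 2 * `|f|.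
Proof.
move=> us; have [phi [phiE phi0 phi1]] := separating_functions us.
exists phi; split=> // f; rewrite mulr_natl mulr2n.
apply: le_trans (ler_normB _ _) _; rewrite lerD2l.
apply: cfun_norm_le => // a; rewrite cfun_sumE.
apply: le_trans (ler_norm_sum _ _ _) _.
apply: (@le_trans _ _ (\sum_(p <- s) `|f| * phi p a)).
  apply: ler_sum => p _.
  by rewrite cfunZE normrM (ger0_norm (phi0 _ _)) ler_wpM2r// cfun_ler_norm.
by rewrite -mulr_sumr ler_piMr.
Qed.

End interpolation.

(** * Compact approximation of the powers of the substitution operator *)

Section substitution_operator.
Variables (R : realType) (A : compactHausdorffType) (rho : substitution A).
Implicit Types (f : cfun R A) (P : set A) (k : nat).
Local Notation M := (subst_op rho : cfun R A -> cfun R A).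

Lemma iter_subst_opE k f a :
  iter k M f a = \sum_(b <- subst_iter rho k a) f b.
Proof.
elim: k f => [|k IH] f; first by rewrite /subst_iter/= big_seq1.
(* The innermost [M] corresponds to the last substitution step, which is outermost in
   [subst_iter]. *)
rewrite iterSr IH /subst_iter iterS big_flatten big_map.
by apply: eq_bigr => b _.
Qed.

Lemma subst_opE f a : M f a = \sum_(b <- letters (rho a)) f b.
Proof. by []. Qed.

Lemma subst_op_linear : linear M.
Proof.
move=> c f g; apply: val_inj; apply/funext => a.
rewrite -[LHS]/(M (c *: f + g) a) -[RHS]/((c *: M f + M g) a).
rewrite cfunDE cfunZE !subst_opE mulr_sumr -big_split.
exact: eq_bigr.
Qed.

Lemma iter_subst_op_linear k : linear (iter k M).
Proof.
by elim: k => [//|k IH] c f g; rewrite !iterS IH subst_op_linear.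
Qed.

(** Letters in [P] contribute 0; each of the at most [maxcount rho k P] other occurrences
    contributes at most |f|. *)
Lemma iter_subst_op_norm P k f :
  {in P, forall p, f p = 0} ->
  `|iter k M f| <= (maxcount rho k P)%:R * `|f|.
Proof.
move=> fP; apply: cfun_norm_le => [|a]; first by rewrite mulr_ge0.
rewrite iter_subst_opE.
set w := subst_iter rho k a.
apply: (@le_trans _ _ (\sum_(b <- w | b \notin P) `|f|)); last first.
  rewrite big_const_seq iter_addr_0 -[leLHS]mulr_natl ler_wpM2r// ler_nat.
  exact: (maxcountP rho k P a).2.
rewrite (bigID (mem P))/= big1 ?add0r => [|b /fP//].
apply: le_trans (ler_norm_sum _ _ _) _.
by apply: ler_sum => b _; exact: cfun_ler_norm.
Qed.

Lemma iter_subst_op_bounded k : bounded_operator (iter k M).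
Proof.
split; first exact: iter_subst_op_linear.
(* For the empty set the vanishing condition is vacuous and every letter is counted. *)
exists (maxcount rho k set0)%:R => f; apply: iter_subst_op_norm => p.
by rewrite inE.
Qed.

(** The error is M^k applied to f - I f, which vanishes on [s], so [iter_subst_op_norm] applies. *)
Lemma iter_subst_op_compact_approx (s : seq A) (phi : A -> cfun R A) (K : R) k :
  uniq s -> {in s &, forall p q, phi p q = (p == q)%:R} ->
  (forall f, `|f - interp s phi f| <= K * `|f|) ->
  compact_operator (iter k M \o interp s phi) /\
  forall f, `|iter k M f - iter k M (interp s phi f)| <=
    K * (maxcount rho k [set` s])%:R * `|f|.
Proof.
move=> us phiE phiK; split=> [|f].
  apply: compact_operator_compl; last exact: interp_compact.
  exact: iter_subst_op_bounded.
have [S SE] := linear_pack (@iter_subst_op_linear k).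
rewrite SE -linearB -SE.
apply: (@le_trans _ _ ((maxcount rho k [set` s])%:R * `|f - interp s phi f|)).
  apply: iter_subst_op_norm => q; rewrite inE/= => qs.
  by rewrite -[LHS]/(f q - interp s phi f q) interpE// subrr.
by rewrite [K * _]mulrC -mulrA ler_wpM2l.
Qed.

End substitution_operator.

Theorem theorem6p9 (R : realType) (A : compactHausdorffType)
    (rho : substitution A) (P : set A) (k : nat) :
  finite_set P -> (0 < k)%N ->
  let M : cfun R A -> cfun R A := subst_op rho in
  let r : R := spectral_radius M in
  let T : cfun R A -> cfun R A := fun f => r^-1 *: M f in
  let Ck : R := (maxcount rho k P)%:R in
  let only_isolated := P `<=` isolated [set: A] in
  [/\ only_isolated -> ess_spectral_radius (iter k M) <= Ck,
      ~ only_isolated -> ess_spectral_radius (iter k M) <= 2 * Ck &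
      (Ck < r ^+ k /\ only_isolated) \/ 2 * Ck < r ^+ k -> quasi_compact T].
Proof.
move=> /finite_seqP[s0 Ps0] k0 M r T Ck only_isolated.
(* A repeated point would be counted twice in the interpolation sum. *)
pose s := undup s0; have us : uniq s := undup_uniq s0.
have Ps : P = [set` s] by apply/seteqP; split=> a; rewrite Ps0 /= mem_undup.
have approx1 : only_isolated -> exists2 C, compact_operator C &
    forall f, `|iter k M f - C f| <= Ck * `|f|.
  rewrite /only_isolated Ps => /(isolated_interp R us)[phi [phiE phi1]].
  have := iter_subst_op_compact_approx (K := 1) rho k us phiE.
  by rewrite mul1r /Ck Ps => -[f|]; [rewrite mul1r|eexists; eauto].
(* This approximation serves both the second bound and the second alternative for
   quasi-compactness. *)
have approx2 : exists2 C, compact_operator C &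
    forall f, `|iter k M f - C f| <= 2 * Ck * `|f|.
  have [phi [phiE phi2]] := separating_interp R us.
  have [cC CP] := iter_subst_op_compact_approx rho k us phiE phi2.
  by rewrite /Ck Ps; eexists; [exact: cC|exact: CP].
have Ck0 : 0 <= Ck by [].
have lM := @subst_op_linear R A rho.
have bM := @iter_subst_op_bounded R A rho.
split=> [/approx1[C cC CP]|_|].
- exact: (ess_spectral_radius_le _ (bM k) cC CP).
- have [C cC CP] := approx2.
  by apply: (ess_spectral_radius_le _ (bM k) cC CP); rewrite mulr_ge0.
case=> [[Ckr /approx1[C cC CP]]|Ckr].
  exact: quasi_compact_normalized cC CP Ckr.
have [C cC CP] := approx2.
by apply: quasi_compact_normalized cC CP Ckr => //; rewrite mulr_ge0.
Qed.
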